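(* Let $G$ be a finite group and let $u$ be a fixed conjugacy class representative of $G$. If $C_G(u)$ is abelian and, for each positive integer $m$, either $\tilde G_m^m(u)=\emptyset$ or $\tilde G_m^m(u)=\{\mathrm{id}\}$, then all irreducible characters of $D(G)$ induced from $C_G(u)$ are I-equivalent.
   Context: For a finite group $G$, the Drinfel'd double $D(G)$ is the semisimple Hopf algebra over $\mathbb{C}$ with basis $\{p_g\bowtie x : g,x\in G\}$, multiplication $(p_k\bowtie z)(p_h\bowtie y)=\delta_{k,zhz^{-1}}\,p_k\bowtie zy$, unit $\sum_{g\in G}p_g\bowtie 1$, comultiplication $\Delta(p_g\bowtie x)=\sum_{h\in G}(p_h\bowtie x)\otimes(p_{h^{-1}g}\bowtie x)$, counit $\epsilon(p_g\bowtie x)=\delta_{g,1}$ and antipode $S(p_g\bowtie x)=p_{x^{-1}g^{-1}x}\bowtie x^{-1}$. Put $\Lambda=\frac1{|G|}\sum_{g\in G}p_1\bowtie g$, and for $m\ge1$ let $\Lambda^{[m]}=\sum\Lambda_1\cdots\Lambda_m$ be the $m$-fold product of the iterated comultiplication of $\Lambda$ ($\Lambda^{[1]}=\Lambda$). For an irreducible character $\chi$ of $D(G)$ (trace function of a simple module), $\nu_m(\chi)=\chi(\Lambda^{[m]})$ is its $m$-th Frobenius-Schur indicator. For $u\in G$ and a simple $\mathbb{C}C_G(u)$-module $V$ with character $\eta$, the space $\hat V=\mathbb{C}G\otimes_{\mathbb{C}C_G(u)}V$ is a simple $D(G)$-module via $(p_h\bowtie x)\cdot(y\otimes v)=\delta_{xyu(xy)^{-1},\,h}\;xy\otimes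 v$ for $h,x,y\in G$, $v\in V$; its character is called the character of $D(G)$ induced from $\eta$ (or induced from $C_G(u)$). Two characters $\chi,\chi'$ of $D(G)$ are I-equivalent if $\nu_m(\chi)=\nu_m(\chi')$ for all positive integers $m$. Define $\tilde G_m(u)=\{h\in G : (uh)^m=h^m\}$; then $h^m\in C_G(u)$ for every $h\in\tilde G_m(u)$. Fix a set $\mathfrak{R}_{C_G(u)}$ of representatives of the conjugacy classes of $C_G(u)$. $\tilde G_m^m(u)$ is the set of all $y\in\mathfrak{R}_{C_G(u)}$ for which there is $h\in\tilde G_m(u)$ with $h^m$ in the $C_G(u)$-conjugacy class of $y$. *)

(* Defs.v *)
From HB Require Import structures.
From mathcomp Require Import all_boot all_order all_algebra all_fingroup.
From mathcomp Require Import mxrepresentation.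
From mathcomp Require Import reals complex.

Set Implicit Arguments.
Unset Strict Implicit.
Unset Printing Implicit Defensive.

Import GRing.Theory.
Local Open Scope ring_scope.

(* An element is its family of coordinates on the basis p_g |><| x, which is
   indexed by the pairs (g, x). *)
Definition ddouble (F : fieldType) (gT : finGroupType) : Type :=
  {ffun gT * gT -> F^o}.

HB.instance Definition _ (F : fieldType) (gT : finGroupType) :=
  GRing.Lmodule.on (ddouble F gT).

Section DrinfeldDouble.
Variables (F : fieldType) (gT : finGroupType).
Local Notation D := (ddouble F gT).
Implicit Types (a b c : D) (p q : gT * gT).

Definition dbasis (g x : gT) : D := [ffun p => (p == (g, x))%:R].

Definition dbasis_mul p q : D :=
  if p.1 == (p.2 * q.1 * p.2^-1)%g then dbasis p.1 (p.2 * q.2)%g else 0.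

Definition dmul a b : D := \sum_p \sum_q (a p * b q) *: dbasis_mul p q.

Definition dunit : D := \sum_(g : gT) dbasis g 1%g.

Lemma ddouble0E p : (0 : D) p = 0.
Proof. exact: ffunE. Qed.

Lemma dmulE a b k w :
  dmul a b (k, w) = \sum_z a (k, z) * b ((z^-1 * k * z)%g, (z^-1 * w)%g).
Proof.
rewrite /dmul sum_ffunE (eq_bigr (fun p => if p.1 == k
   then a (p.1, p.2) * b ((p.2^-1 * k * p.2)%g, (p.2^-1 * w)%g) else 0)).
  rewrite -(pair_bigA _ (fun g z => if g == k
     then a (g, z) * b ((z^-1 * k * z)%g, (z^-1 * w)%g) else 0)) /=.
  rewrite (bigD1 k) //= [X in _ + X]big1 ?addr0.
    by apply: eq_bigr => z _; rewrite eqxx.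
  by move=> g /negPf ne; rewrite big1 // => z _; rewrite ne.
case=> g x _; rewrite sum_ffunE /= (bigD1 ((x^-1 * k * x)%g, (x^-1 * w)%g)) //=.
rewrite big1 ?addr0 => [|[h y] /= /eqP ne].
  rewrite ffunE /dbasis_mul /= !mulgA mulgV !mul1g mulgK.
  have [->|_] := eqVneq g k; first by rewrite ffunE eqxx [LHS]mulr1.
  by rewrite ddouble0E [LHS]mulr0.
rewrite ffunE /dbasis_mul /=; case: eqP => [E|_]; last by rewrite ddouble0E [LHS]mulr0.
rewrite ffunE; case: eqP => [[E1 E2]|_]; last by rewrite [LHS]mulr0.
by case: ne; rewrite E1 E2 E !mulgA mulVg !mul1g mulgKV.
Qed.

Lemma dunitE k w : dunit (k, w) = (w == 1%g)%:R.
Proof.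
rewrite /dunit sum_ffunE (bigD1 k) //= big1 ?addr0.
  by rewrite ffunE xpair_eqE eqxx.
by move=> g /negPf ne; rewrite ffunE xpair_eqE eq_sym ne.
Qed.

Fact dmulA : associative dmul.
Proof.
move=> a b c; apply/ffunP => -[k w]; rewrite !dmulE.
under [RHS]eq_bigr do rewrite dmulE mulr_suml.
rewrite exchange_big; apply: eq_bigr => y _ /=.
rewrite dmulE mulr_sumr (reindex_inj (mulgI y^-1)%g) /=.
apply: eq_bigr => z _; rewrite mulrA; congr (_ * c (_, _)).
  by rewrite invMg invgK !mulgA !mulgK.
by rewrite invMg invgK !mulgA mulgK.
Qed.

Fact dmul1l : left_id dunit dmul.
Proof.
move=> a; apply/ffunP => -[k w]; rewrite dmulE (bigD1 1%g) //= big1 ?addr0.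
  by rewrite dunitE eqxx mul1r invg1 !mul1g mulg1.
by move=> z /negPf ne; rewrite dunitE ne mul0r.
Qed.

Fact dmul1r : right_id dunit dmul.
Proof.
move=> a; apply/ffunP => -[k w]; rewrite dmulE (bigD1 w) //= big1 ?addr0.
  by rewrite dunitE mulVg eqxx mulr1.
by move=> z ne; rewrite dunitE -eq_mulVg1 (negPf ne) mulr0.
Qed.

Fact dmulDl : left_distributive dmul +%R.
Proof.
move=> a b c; apply/ffunP => -[k w]; rewrite ffunE !dmulE -big_split /=.
by apply: eq_bigr => z _; rewrite ffunE mulrDl.
Qed.

Fact dmulDr : right_distributive dmul +%R.
Proof.
move=> a b c; apply/ffunP => -[k w]; rewrite ffunE !dmulE -big_split /=.
by apply: eq_bigr => z _; rewrite ffunE mulrDr.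
Qed.

Fact dunit_neq0 : dunit != 0.
Proof.
apply/eqP => /ffunP/(_ (1%g, 1%g)); rewrite dunitE ffunE eqxx.
by move/eqP; rewrite oner_eq0.
Qed.

HB.instance Definition _ := GRing.Zmodule_isNzRing.Build D
  dmulA dmul1l dmul1r dmulDl dmulDr dunit_neq0.

(* The m-th tensor power of D, by coordinates on the basis of the tensors
   e_1 (x) ... (x) e_m with each e_i = p_g |><| x, indexed by the m-tuples of
   pairs (g, x). *)
Definition dtensor (m : nat) := {ffun m.-tuple (gT * gT) -> F^o}.

Definition tbasis m (t : m.-tuple (gT * gT)) : dtensor m :=
  [ffun s => (s == t)%:R].

(* Delta (x) id (x) ... (x) id *)
Definition comul_head m (w : dtensor m.+1) : dtensor m.+2 :=
  \sum_t w t *: \sum_h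
     let: (g, x) := thead t in
     tbasis [tuple of (h, x) :: ((h^-1 * g)%g, x) :: behead t].

(* The iterated comultiplication of D into its (k+1)-st tensor power. *)
Fixpoint iter_comul k (a : D) : dtensor k.+1 :=
  if k is k'.+1 then comul_head (iter_comul k' a)
  else \sum_p a p *: tbasis [tuple p].

Definition iter_mul m (w : dtensor m) : D :=
  \sum_t w t *: \prod_(p <- t) dbasis p.1 p.2.

Definition dintegral : D :=
  (#|gT|%:R)^-1 *: \sum_(g : gT) dbasis 1%g g.

(* Lambda^[m]; only meaningful for m >= 1. *)
Definition integral_power (m : nat) : D :=
  iter_mul (iter_comul m.-1 dintegral).

Definition FS_indicator (m : nat) (chi : D -> F) : F :=
  chi (integral_power m).

Definition I_equivalent (chi chi' : D -> F) : Prop :=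
  forall m : nat, (0 < m)%N -> FS_indicator m chi = FS_indicator m chi'.

End DrinfeldDouble.

Definition lfun_trace (F : fieldType) (W : vectType F) (f : 'End(W)) : F :=
  \tr (passmx.mxof (vbasis {:W}) (vbasis {:W}) f).

(* The representation rV makes V = 'cV_n a left module over F C_G(u), with c
   acting by v |-> rV c *m v. The library's mx_irreducible rV speaks of row
   vectors instead; over a field this is equivalent to the simplicity of V,
   by passing to orthogonals of submodules. *)
Section InducedModule.
Variables (F : fieldType) (gT : finGroupType) (u : gT) (n : nat).
Variable rV : mx_representation F 'C[u]%g n.
Local Notation D := (ddouble F gT).

(* The tensor product of FG and V over F, i.e., the direct sum of the
   y (x) V for y in G. *)
Definition pretensor : vectType F := {ffun gT -> 'cV[F]_n}.

Definition pretens (y : gT) (v : 'cV[F]_n) : pretensor :=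
  [ffun z => if z == y then v else 0].

Definition balance_rel (y c : gT) (v : 'cV[F]_n) : pretensor :=
  pretens (y * c)%g v - pretens y (rV c *m v).

Definition balance_space : {vspace pretensor} :=
  (\sum_(y : gT) \sum_(c in 'C[u]%g) limg (linfun (balance_rel y c)))%VS.

(* There are no quotients of vector spaces in the library: the tensor product
   over F C_G(u), the quotient of pretensor by balance_space, is realised on
   the complement of balance_space, and ind_pi is the canonical surjection. *)
Definition ind_space : vectType F := subvs_of (balance_space^C)%VS.

Definition ind_pi (w : pretensor) : ind_space :=
  vsproj (balance_space^C)%VS (daddv_pi (balance_space^C)%VS balance_space w).

Definition tens (y : gT) (v : 'cV[F]_n) : ind_space := ind_pi (pretens y v).

Definition basis_act (h x y : gT) (v : 'cV[F]_n) : pretensor :=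
  if (x * y * u * (x * y)^-1)%g == h then pretens (x * y)%g v else 0.

Definition pre_act (a : D) (w : pretensor) : pretensor :=
  \sum_(p : gT * gT) a p *: \sum_(y : gT) basis_act p.1 p.2 y (w y).

(* On the tensors y (x) v, the action is given by ind_act_tens below. *)
Definition ind_act (a : D) : 'End(ind_space) :=
  linfun (fun w : ind_space => ind_pi (pre_act a (vsval w))).

Definition ind_char (a : D) : F := lfun_trace (ind_act a).

Lemma pretens_linear y : linear (pretens y).
Proof.
move=> k v w; apply/ffunP => z; rewrite !ffunE.
by case: eqP => _; rewrite ?scaler0 ?addr0.
Qed.

HB.instance Definition _ y := GRing.isSemilinear.Build F _ pretensor _
  (pretens y) (GRing.semilinear_linear (pretens_linear y)).

Lemma balance_rel_linear y c : linear (balance_rel y c).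
Proof.
move=> k v w; rewrite /balance_rel !linearP /=.
by rewrite addrACA -scalerDr.
Qed.

HB.instance Definition _ y c := GRing.isSemilinear.Build F _ pretensor _
  (balance_rel y c) (GRing.semilinear_linear (balance_rel_linear y c)).

Lemma ind_pi_linear : linear ind_pi.
Proof. by move=> k w1 w2; rewrite /ind_pi !linearP. Qed.

HB.instance Definition _ := GRing.isSemilinear.Build F pretensor ind_space _
  ind_pi (GRing.semilinear_linear ind_pi_linear).

Lemma compl_cap : (balance_space^C :&: balance_space = 0)%VS.
Proof. by rewrite capvC capv_compl. Qed.

Lemma mem_compl_add w : w \in (balance_space^C + balance_space)%VS.
Proof. by rewrite addvC addv_complf memvf. Qed.

Lemma ind_pi_eq0 w : (ind_pi w == 0) = (w \in balance_space).
Proof.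
have defw := daddv_pi_add compl_cap (mem_compl_add w).
apply/eqP/idP => [E|wB].
  have /(congr1 vsval) := E.
  rewrite /ind_pi vsprojK ?memv_pi // linear0 => E0.
  by rewrite -defw E0 add0r memv_pi.
rewrite /ind_pi; move/eqP: defw; rewrite (daddv_pi_id (capv_compl _)) //.
by rewrite -subr_eq0 addrK => /eqP ->; rewrite linear0.
Qed.

Lemma ind_pi_surj (w : ind_space) : ind_pi (vsval w) = w.
Proof. by rewrite /ind_pi daddv_pi_id ?compl_cap ?subvsP // vsvalK. Qed.

Lemma balance_rel_in y c v :
  c \in 'C[u]%g -> balance_rel y c v \in balance_space.
Proof.
move=> cC; rewrite -[balance_rel y c v]lfunE.
have sub : (limg (linfun (balance_rel y c)) <= balance_space)%VS.
  by apply: (sumv_sup y) => //; apply: (sumv_sup c).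
by apply: (subvP sub); apply: memv_img; apply: memvf.
Qed.

Lemma tensMr y c v : c \in 'C[u]%g -> tens (y * c)%g v = tens y (rV c *m v).
Proof.
move=> cC; apply/eqP; rewrite -subr_eq0 -linearB ind_pi_eq0.
exact: balance_rel_in.
Qed.

Lemma pre_act_linear a : linear (pre_act a).
Proof.
move=> k v w; rewrite /pre_act (scaler_sumr k) -big_split.
apply: eq_bigr => p _ /=; rewrite scalerA [k * _]mulrC -scalerA -scalerDr.
rewrite (scaler_sumr k) -big_split; congr (_ *: _); apply: eq_bigr => y _.
rewrite /basis_act /= !ffunE.
by case: eqP => _; rewrite ?scaler0 ?addr0 // linearP.
Qed.

HB.instance Definition _ a := GRing.isSemilinear.Build F pretensor pretensor _
  (pre_act a) (GRing.semilinear_linear (pre_act_linear a)).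

Lemma pre_act_pretens a y v :
  pre_act a (pretens y v) = \sum_p a p *: basis_act p.1 p.2 y v.
Proof.
apply: eq_bigr => p _; congr (_ *: _); rewrite (bigD1 y) //= ffunE eqxx.
rewrite big1 ?addr0 // => z /negPf ne; rewrite ffunE ne /basis_act linear0.
by case: eqP.
Qed.

Lemma pre_act_balance a w :
  w \in balance_space -> pre_act a w \in balance_space.
Proof.
move=> wB; rewrite -ind_pi_eq0.
have sub : (balance_space <= lker (linfun (ind_pi \o pre_act a)))%VS.
  apply/subv_sumP => y _; apply/subv_sumP => c cC; apply/subvP => _ /memv_imgP[v _ ->].
  rewrite memv_ker !lfunE /= ind_pi_eq0 /balance_rel linearB /= !pre_act_pretens -sumrB.
  apply: memv_suml => -[h x] _ /=; rewrite -scalerBr memvZ // /basis_act mulgA.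
  have -> : (x * y * c * u * (x * y * c)^-1 = x * y * u * (x * y)^-1)%g.
    by rewrite invMg -!mulgA (mulgA c) (cent1P cC) -mulgA mulKVg.
  by case: eqP => _; rewrite ?subr0 ?mem0v //; apply: balance_rel_in.
by have := subvP sub _ wB; rewrite memv_ker lfunE.
Qed.

Lemma ind_act_pi a w : ind_act a (ind_pi w) = ind_pi (pre_act a w).
Proof.
rewrite -[ind_act a]/(linfun ((ind_pi \o pre_act a) \o vsval)) lfunE /=.
apply/eqP; rewrite -subr_eq0 -!linearB ind_pi_eq0 pre_act_balance //.
by rewrite -ind_pi_eq0 linearB /= ind_pi_surj subrr.
Qed.

Lemma ind_act_tens h x y v :
  ind_act (dbasis F h x) (tens y v) =
    if (x * y * u * (x * y)^-1)%g == h then tens (x * y)%g v else 0.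
Proof.
rewrite ind_act_pi pre_act_pretens (bigD1 (h, x)) //= big1 => [|p /negPf ne].
  rewrite ffunE eqxx scale1r addr0 /basis_act.
  by case: eqP => // _; rewrite linear0.
by rewrite ffunE ne scale0r.
Qed.

End InducedModule.

(* The induced module is simple because V is; no separate irreducibility
   condition on chi is therefore imposed. *)
Definition induced_character (F : fieldType) (gT : finGroupType) (u : gT)
    (chi : ddouble F gT -> F) : Prop :=
  exists (n : nat) (rV : mx_representation F 'C[u]%g n),
    mx_irreducible rV /\ chi =1 ind_char rV.

Section PowerSets.
Variable gT : finGroupType.
Local Open Scope group_scope.

Definition Gtilde (m : nat) (u : gT) : {set gT} :=
  [set h | (u * h) ^+ m == h ^+ m].

Definition Gtilde_pow (Reps : {set gT}) (m : nat) (u : gT) : {set gT} :=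
  [set y in Reps | [exists h in Gtilde m u, h ^+ m \in y ^: 'C[u]]].

End PowerSets.

(* Main.v *)
Require Import Defs.
From HB Require Import structures.
From mathcomp Require Import all_boot all_order all_algebra all_fingroup.
From mathcomp Require Import mxrepresentation.
From mathcomp Require Import reals complex.

(** The point is that Lambda^[m] acts on each induced module as a scalar, and
    that neither this scalar nor the dimension of the module depends on the
    inducing representation.

    The component y (x) V of the induced module has degree w = y u y^-1, in the
    sense that p_h |><| x maps it to the component of x y if h = x w x^-1 and
    kills it otherwise.  Now Lambda^[m] is |G|^-1 times the sum, over x and over
    the h_1, ..., h_m of product 1, of the monomials
    (p_{h_1} |><| x) ... (p_{h_m} |><| x).  Reading such a monomial from the
    right, it does not kill y (x) v only if h_m = x w x^-1, then
    h_{m-1} = x^2 w x^-2, and so on up to h_1 = x^m w x^-m.  So each x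
    contributes at most one monomial, and the product of its h_i is
    x^m (w x^-1)^m.  Requiring this to be 1 and substituting x = y h^-1 y^-1
    gives (integral_power_tens)

      Lambda^[m] . (y (x) v) = |G|^-1 sum_{h : (u h)^m = h^m} y h^-m (x) v.

    The h^m that occur here commute with u, and the hypothesis on their classes
    forces them all to be 1 (Gtilde_pow1).  Thus Lambda^[m] acts as the scalar
    |Gtilde_m(u)| / |G|, and the m-th indicator is this scalar times the
    dimension of the induced module.  That dimension depends only on dim V
    (dim_ind_space), and dim V = 1 because 'C[u] is abelian and the field is
    algebraically closed. *)

Set Implicit Arguments.
Unset Strict Implicit.
Unset Printing Implicit Defensive.

Import GRing.Theory.

(** * Coordinates of the iterated comultiplication *)

Section IteratedComultiplication.
Local Open Scope ring_scope.
Variables (F : fieldType) (gT : finGroupType).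
Local Notation D := (ddouble F gT).

(** In coordinates the comultiplication is the transpose of a multiplication:
    (h, x) and (h', x) come from the single basis element (h h', x). *)
Lemma comul_headE m (w : dtensor F gT m.+1) (p q : gT * gT)
    (s : m.-tuple (gT * gT)) :
  comul_head w [tuple of p :: q :: s] =
    if p.2 == q.2 then w [tuple of ((p.1 * q.1)%g, p.2) :: s] else 0.
Proof.
case: p q => [g x] [h y] /=.
(* Only t0 can produce the given tensor, and only through the summand h = g. *)
pose t0 : m.+1.-tuple (gT * gT) := [tuple of ((g * h)%g, x) :: s].
rewrite /comul_head sum_ffunE (bigD1 t0) //= [X in _ + X]big1 => [|t ne].
  rewrite addr0 ffunE /t0 sum_ffunE (bigD1 g) //= big1 => [|k /negPf ne].
    rewrite addr0 ffunE -val_eqE /= !eqseq_cons !xpair_eqE mulKg !eqxx andbT /=.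
    by rewrite [y == x]eq_sym; case: (x == y); rewrite ?[LHS]mulr1 // [LHS]mulr0.
  by rewrite ffunE -val_eqE /= eqseq_cons xpair_eqE eq_sym ne.
case/tupleP: t ne => -[k z] t ne; rewrite ffunE theadE sum_ffunE.
rewrite big1 ?[LHS]mulr0 // => l _; rewrite ffunE -val_eqE /= !eqseq_cons.
case: eqP => //= -[El Ez]; case: eqP => //= -[Eh Ey]; case: eqP => //= Es.
case/eqP: ne; apply: val_inj => /=; rewrite Es -Ez Eh -El.
by rewrite mulKVg.
Qed.

(** This closed form is symmetric in the tensor factors, so that it does not
    matter that the recursion always splits the head. *)
Lemma iter_comulE k (a : D) (p : gT * gT) (s : k.-tuple (gT * gT)) :
  iter_comul k a [tuple of p :: s] =
    if all (fun q => q.2 == p.2) s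
    then a ((\prod_(q <- p :: s) q.1)%g, p.2) else 0.
Proof.
elim: k p s => [|k IHk] p s.
  rewrite tuple0 /= sum_ffunE (bigD1 p) //= big1 => [|q /negPf ne].
    rewrite !ffunE -val_eqE /= eqxx [X in X + 0]mulr1 addr0.
    by rewrite big_seq1; case: p.
  by rewrite !ffunE -val_eqE /= eqseq_cons eq_sym ne [LHS]mulr0.
case/tupleP: s => q s.
rewrite -[iter_comul _ _]/(comul_head (iter_comul k a)).
have -> : [tuple of p :: [tuple of q :: s]] = [tuple of p :: q :: s].
  exact: val_inj.
rewrite comul_headE IHk /= eq_sym !big_cons /= mulgA.
by case: eqP.
Qed.

Lemma dintegralE g x : dintegral F gT (g, x) = (#|gT|%:R)^-1 * (g == 1%g)%:R.
Proof.
rewrite ffunE sum_ffunE (bigD1 x) //= big1 => [|y /negPf ne].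
  by rewrite addr0 ffunE xpair_eqE eqxx andbT.
by rewrite ffunE xpair_eqE [x == y]eq_sym ne andbF.
Qed.

End IteratedComultiplication.

(** * The induced module is a module *)

Section InducedAction.
Local Open Scope ring_scope.
Variables (F : fieldType) (gT : finGroupType) (u : gT) (n : nat).
Variable rV : mx_representation F 'C[u]%g n.
Local Notation D := (ddouble F gT).
Implicit Types (a b : D) (f g : 'End(ind_space rV)).

(** The action as a function of the algebra element, named so that it can be
    given its linear structure. *)
Definition act_on w a := ind_act rV a w.

Lemma act_on_linear w : linear (act_on w).
Proof.
move=> k a b; rewrite /act_on -(ind_pi_surj w) !ind_act_pi -linearP.
congr (ind_pi _ _).
rewrite /pre_act (scaler_sumr k) -big_split; apply: eq_bigr => p _ /=.
by rewrite !ffunE scalerDl scalerA.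
Qed.

HB.instance Definition _ w := GRing.isSemilinear.Build F D (ind_space rV) _
  (act_on w) (GRing.semilinear_linear (act_on_linear w)).

Lemma ind_act_sumZ (I : Type) (r : seq I) (c : I -> F) (a : I -> D) w :
  ind_act rV (\sum_(i <- r) c i *: a i) w =
    \sum_(i <- r) c i *: ind_act rV (a i) w.
Proof.
rewrite -[LHS]/(act_on w _) linear_sum.
by apply: eq_bigr => i _; rewrite linearZ.
Qed.

Lemma eq_on_tens f g :
  (forall y v, f (tens rV y v) = g (tens rV y v)) -> f = g.
Proof.
move=> fg; apply/lfunP => w; rewrite -(ind_pi_surj w).
have -> : vsval w = \sum_y pretens y (vsval w y).
  apply/ffunP => z; rewrite sum_ffunE (bigD1 z) //= ffunE eqxx.
  by rewrite big1 ?addr0 // => y /negPf ne; rewrite ffunE eq_sym ne.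
by rewrite !linear_sum; apply: eq_bigr => y _; apply: fg.
Qed.

Lemma ind_act1 : ind_act rV 1 = \1%VF.
Proof.
apply: eq_on_tens => y v; rewrite id_lfunE.
rewrite -[1]/(dunit F gT) /dunit.
have -> : \sum_g dbasis F g 1%g = \sum_g 1 *: dbasis F g (1%g : gT).
  by apply: eq_bigr => g _; rewrite scale1r.
(* Of the idempotents p_g |><| 1, only that of the degree of y (x) v survives. *)
rewrite ind_act_sumZ (bigD1 (y * u * y^-1)%g) //= ind_act_tens mul1g eqxx.
rewrite scale1r big1 ?addr0 // => h ne.
by rewrite ind_act_tens mul1g eq_sym (negPf ne) scaler0.
Qed.

Lemma ind_act_basisM p q w :
  ind_act rV (dbasis_mul F p q) w =
    ind_act rV (dbasis F p.1 p.2) (ind_act rV (dbasis F q.1 q.2) w).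
Proof.
suff -> : ind_act rV (dbasis_mul F p q) =
    (ind_act rV (dbasis F p.1 p.2) \o ind_act rV (dbasis F q.1 q.2))%VF.
  by rewrite comp_lfunE.
apply: eq_on_tens => y v; rewrite comp_lfunE ind_act_tens /dbasis_mul.
case: p q => [k z] [h x] /=; set A := (x * y * u * _)%g.
have EA : (z * x * y * u * (z * x * y)^-1 = z * A * z^-1)%g.
  by rewrite /A !invMg !mulgA.
have [Ek|nk] := eqVneq k (z * h * z^-1)%g.
  rewrite ind_act_tens EA Ek (inj_eq (mulIg _)) (inj_eq (mulgI _)).
  case: eqP => [Eh|_]; last by rewrite linear0.
  by rewrite ind_act_tens mulgA EA Eh eqxx.
rewrite -[ind_act rV 0 _]/(act_on (tens rV y v) 0) linear0.
case: eqP => [Eh|_]; last by rewrite linear0.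
by rewrite ind_act_tens mulgA EA Eh eq_sym (negPf nk).
Qed.

Lemma ddouble_basis a : a = \sum_p a p *: dbasis F p.1 p.2.
Proof.
apply/ffunP => p; rewrite sum_ffunE (bigD1 p) //= big1 => [|q /negPf ne].
  by rewrite !ffunE -surjective_pairing eqxx addr0 [RHS]mulr1.
by rewrite !ffunE -surjective_pairing eq_sym ne [LHS]mulr0.
Qed.

Lemma ind_actM a b : ind_act rV (a * b) = (ind_act rV a \o ind_act rV b)%VF.
Proof.
apply/lfunP => w; rewrite comp_lfunE [in RHS](ddouble_basis a) ind_act_sumZ.
rewrite -[a * b]/(dmul a b) /dmul.
rewrite -[LHS]/(act_on w _) linear_sum; apply: eq_bigr => p _.
rewrite [in RHS](ddouble_basis b) ind_act_sumZ !linear_sum /=.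
apply: eq_bigr => q _.
rewrite [in RHS]linearZ /= -ind_act_basisM scalerA; exact: linearZ.
Qed.

(** * The action of the powers of the integral *)

(** The only possible first components of a product of k elements p_h |><| x
    that does not kill a vector of degree w. *)
Fixpoint weights (w x : gT) k : k.-tuple gT :=
  if k is k'.+1 then [tuple of (x ^+ k * w * x ^- k)%g :: weights w x k']
  else [tuple].

Lemma prod_weights w x k :
  (\prod_(h <- weights w x k) h = x ^+ k * (w * x^-1) ^+ k)%g.
Proof.
elim: k => [|k IHk] /=; first by rewrite big_nil mulg1.
rewrite big_cons IHk [in (x ^- _)%g]expgSr invMg (expgS (w * _)%g).
by rewrite !mulgA mulgKV.
Qed.

Lemma ind_act_prod x (s : seq gT) y v :
  ind_act rV (\prod_(h <- s) dbasis F h x) (tens rV y v) =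
    if s == weights (y * u * y^-1)%g x (size s) then
      tens rV (x ^+ size s * y)%g v else 0.
Proof.
elim: s => [|h s IHs]; first by rewrite big_nil ind_act1 id_lfunE mul1g.
rewrite big_cons ind_actM comp_lfunE IHs /= eqseq_cons andbC.
case: eqP => _; last by rewrite linear0.
rewrite ind_act_tens [(x * (_ * y))%g]mulgA -expgS [_ == h]eq_sym /=.
by rewrite invMg !mulgA.
Qed.

(** Each x contributes at most one tensor to Lambda^[m], the weights of
    y u y^-1 paired with x. *)
Lemma integral_power_tens_sum k y v (w := (y * u * y^-1)%g) :
  ind_act rV (integral_power F gT k.+1) (tens rV y v) =
    \sum_x (#|gT|%:R^-1 * ((x ^+ k.+1 * (w * x^-1) ^+ k.+1)%g == 1%g)%:R)
              *: tens rV (x ^+ k.+1 * y)%g v.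
Proof.
pose T x : k.+1.-tuple (gT * gT) :=
  [tuple of [seq (h, x) | h <- weights w x k.+1]].
pose c x : F :=
  #|gT|%:R^-1 * ((x ^+ k.+1 * (w * x^-1) ^+ k.+1)%g == 1%g)%:R.
pose term x := c x *: tens rV (x ^+ k.+1 * y)%g v.
rewrite /integral_power /iter_mul ind_act_sumZ /=.
transitivity (\sum_(t : k.+1.-tuple (gT * gT)) \sum_(x | T x == t) term x).
  apply: eq_bigr => t _; case/tupleP: t => -[g x] t.
  rewrite iter_comulE /=; have [/allP tx|ntx] := boolP (all _ _); last first.
    (* T z has constant second components, so it is none of these tensors. *)
    rewrite scale0r big1 // => z /eqP/(congr1 val) /= [_ Ez Et].
    case/allP: ntx => q; rewrite -Et => /mapP[h _ ->].
    by rewrite /= Ez.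
  pose s := g :: [seq q.1 | q <- t].
  have Et : (g, x) :: t = [seq (h, x) | h <- s].
    rewrite /s /= -map_comp; congr (_ :: _); rewrite -[LHS]map_id.
    by apply/eq_in_map => -[h z] /tx /= /eqP ->.
  have sz_s : size s = k.+1 by rewrite /s /= size_map size_tuple.
  have ET z : (T z == [tuple of (g, x) :: t]) =
              (z == x) && (s == weights w x k.+1).
    rewrite -val_eqE [val [tuple of _ :: _]]Et.
    rewrite -[val (T z)]/[seq (h, z) | h <- weights w z k.+1].
    have inj_pair : injective (fun h : gT => (h, x)) by move=> h1 h2 [].
    apply/eqP/andP => [Ez | [/eqP -> /eqP <-] //].
    have Ezx : z = x by case: Ez.
    by split; apply/eqP => //; apply: (inj_map inj_pair); rewrite -Ez Ezx.
  have EL : \prod_(q <- (g, x) :: t) dbasis F q.1 q.2 =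
            \prod_(h <- s) dbasis F h x.
    by rewrite Et big_map.
  have Eg : (\prod_(q <- (g, x) :: t) q.1 = \prod_(h <- s) h)%g.
    by rewrite Et big_map.
  rewrite EL Eg dintegralE ind_act_prod sz_s -/w.
  under eq_bigl do rewrite ET.
  have [Es|_] := eqVneq s; last first.
    by rewrite scaler0 big_pred0 // => z; rewrite andbF.
  under eq_bigl do rewrite andbT.
  by rewrite big_pred1_eq /term /c -prod_weights -Es.
rewrite (exchange_big_dep xpredT) //=.
by apply: eq_bigr => x _; rewrite (big_pred1 (T x)) // => t; apply: eq_sym.
Qed.

Lemma integral_power_tens m y v : (0 < m)%N ->
  ind_act rV (integral_power F gT m) (tens rV y v) =
    (#|gT|%:R)^-1 *: \sum_(h in Gtilde m u) tens rV (y * h ^- m)%g v.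
Proof.
case: m => // k _; rewrite integral_power_tens_sum.
rewrite scaler_sumr [RHS]big_mkcond /=.
(* The substitution x = y h^-1 y^-1. *)
rewrite (reindex_inj invg_inj) (reindex_inj (conjg_inj y^-1)%g) /=.
apply: eq_bigr => h _.
have -> : (y * u * y^-1 = u ^ y^-1)%g by rewrite conjgE invgK mulgA.
rewrite invgK -conjVg -!conjXg -conjMg -conjXg -conjMg conjg_eq1.
rewrite expgVn conjgE invgK mulgA mulgKV inE -eq_mulVg1 [(h ^+ _)%g == _]eq_sym.
by case: eqP => _ /=; rewrite ?mulr1 ?mulr0 ?scale0r.
Qed.

Lemma integral_power_scalar m : (0 < m)%N ->
    (forall h, h \in Gtilde m u -> (h ^+ m = 1)%g) ->
  ind_act rV (integral_power F gT m) =
    (#|gT|%:R^-1 * #|Gtilde m u|%:R) *: \1%VF.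
Proof.
move=> m_gt0 pow1; apply: eq_on_tens => y v.
rewrite integral_power_tens // scale_lfunE id_lfunE -scalerA scaler_nat.
congr (_ *: _); rewrite -sumr_const; apply: eq_bigr => h /pow1 ->.
by rewrite invg1 mulg1.
Qed.

End InducedAction.

(** * The dimension of the induced module *)

Section Dimension.
Local Open Scope ring_scope.
Variables (F : fieldType) (gT : finGroupType) (u : gT) (n : nat).
Implicit Types rV : mx_representation F 'C[u]%g n.

(** The 'C[u]-component of y for the chosen transversal of the left cosets. *)
Definition cent_part (y : gT) : gT := ((repr (y *: 'C[u]))^-1 * y)%g.

Lemma cent_part_in y : cent_part y \in 'C[u]%g.
Proof.
have := mem_repr y (lcoset_refl 'C[u]%G y).
by rewrite mem_lcoset -groupV invMg invgK.
Qed.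

Lemma cent_partM y c : c \in 'C[u]%g -> cent_part (y * c) = (cent_part y * c)%g.
Proof. by move=> cC; rewrite /cent_part lcosetM lcoset_id // mulgA. Qed.

(** On the component y (x) V, with y = t c for the representative t, the
    untwisting y (x) v |-> t (x) rV c v that identifies this component with that
    of t, followed by the inverse of the same map for rV'. Hence it turns the
    relations that define the tensor product for rV into those for rV'. *)
Definition twist rV rV' (w : pretensor F gT n) : pretensor F gT n :=
  [ffun y => rV' (cent_part y)^-1%g *m (rV (cent_part y) *m w y)].

Lemma twist_linear rV rV' : linear (twist rV rV').
Proof.
by move=> k w1 w2; apply/ffunP => y; rewrite !ffunE !mulmxDr !scalemxAr.
Qed.

HB.instance Definition _ rV rV' := GRing.isSemilinear.Build F _ _ _
  (twist rV rV') (GRing.semilinear_linear (twist_linear rV rV')).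

Lemma twist_pretens rV rV' y v :
  twist rV rV' (pretens y v) =
    pretens y (rV' (cent_part y)^-1%g *m (rV (cent_part y) *m v)).
Proof.
by apply/ffunP => z; rewrite !ffunE; case: eqP => [->//|_]; rewrite !mulmx0.
Qed.

Lemma twist_inj rV rV' : injective (twist rV rV').
Proof.
move=> w1 w2 /ffunP E; apply/ffunP => y; have := E y; rewrite !ffunE => Ey.
have yC := cent_part_in y.
apply: (can_inj (mulKmx (repr_mx_unit rV yC))).
apply: (can_inj (mulKmx (repr_mx_unit rV' (groupVr yC)))).
exact: Ey.
Qed.

Lemma twist_balance_rel rV rV' y c v : c \in 'C[u]%g ->
  exists v', twist rV rV' (balance_rel rV y c v) = balance_rel rV' y c v'.
Proof.
move=> cC; have yC := cent_part_in y.
exists (rV' (cent_part y * c)^-1%g *m (rV (cent_part y * c)%g *m v)).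
rewrite /balance_rel linearB /= !twist_pretens cent_partM //.
congr (_ - pretens y _).
have dcC : ((cent_part y * c)^-1 \in 'C[u])%g by rewrite groupV groupM.
rewrite [RHS]mulmxA -(repr_mxM rV' cC dcC) (invMg (cent_part y) c) mulKVg.
by rewrite (repr_mxM rV yC cC) -(mulmxA (rV _)).
Qed.

(** twist is injective and maps one space of relations into the other; the
    reverse inequality comes from exchanging the representations. *)
Lemma leq_dim_balance rV rV' :
  (\dim (balance_space rV) <= \dim (balance_space rV'))%N.
Proof.
have ker0 : (balance_space rV :&: lker (linfun (twist rV rV')) = 0)%VS.
  apply/eqP; rewrite -subv0; apply/subvP => w /memv_capP[_].
  rewrite memv_ker memv0 lfunE /= => /eqP Ew; apply/eqP.
  by apply: (@twist_inj rV rV'); rewrite Ew linear0.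
rewrite -(limg_dim_eq ker0); apply: dimvS; apply/subvP => _ /memv_imgP[w wB ->].
suff sub : (balance_space rV <=
    linfun (twist rV rV') @^-1: balance_space rV')%VS.
  by rewrite memv_preim (subvP sub).
apply/subv_sumP => y _; apply/subv_sumP => c cC.
apply/subvP => _ /memv_imgP[v _ ->]; rewrite -memv_preim !lfunE /=.
have [v' ->] := twist_balance_rel rV rV' y v cC.
exact: balance_rel_in.
Qed.

Lemma dim_ind_space rV rV' : \dim {:ind_space rV} = \dim {:ind_space rV'}.
Proof.
rewrite !dimvf -[LHS]/(\dim (balance_space rV)^C)%VS.
rewrite -[RHS]/(\dim (balance_space rV')^C)%VS !dimv_compl.
by congr (_ - _)%N; apply/eqP; rewrite eqn_leq !leq_dim_balance.
Qed.

End Dimension.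

(** * The indicators of induced characters *)

Section Trace.
Import passmx.
Local Open Scope ring_scope.

Lemma lfun_trace_scalar (F : fieldType) (W : vectType F) (c : F) :
  lfun_trace (c *: \1 : 'End(W))%VF = c *+ \dim {:W}.
Proof.
rewrite /lfun_trace linearZ /= mxof1 ?(basis_free (vbasisP _)) //.
by rewrite mxtraceZ mxtrace1 mulr_natr.
Qed.

End Trace.

Lemma FS_indicator_ind_char (F : fieldType) (gT : finGroupType) (u : gT)
    (n m : nat) (rV rV' : mx_representation F 'C[u]%g n) : (0 < m)%N ->
    (forall h, h \in Gtilde m u -> (h ^+ m = 1)%g) ->
  FS_indicator m (ind_char rV) = FS_indicator m (ind_char rV').
Proof.
move=> m_gt0 pow1; rewrite /FS_indicator /ind_char.
rewrite (integral_power_scalar rV m_gt0 pow1).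
rewrite (integral_power_scalar rV' m_gt0 pow1).
rewrite 2!lfun_trace_scalar.
by rewrite (dim_ind_space rV rV').
Qed.

Local Open Scope group_scope.

(** h^m = (u h)^m commutes with both h and u h, hence with u. *)
Lemma Gtilde_pow_cent (gT : finGroupType) m (u h : gT) :
  h \in Gtilde m u -> h ^+ m \in 'C[u].
Proof.
rewrite inE cent1C => /eqP E.
have uhC : u * h \in 'C[h ^+ m] by rewrite -E cent1C groupX ?cent1id.
have hC : h \in 'C[h ^+ m] by rewrite cent1C groupX ?cent1id.
by rewrite -[u](mulgK h) groupM ?groupV.
Qed.

(** The class of h^m in 'C[u] has a representative, which the hypothesis on
    Gtilde_pow can only allow to be 1. *)
Lemma Gtilde_pow1 (gT : finGroupType) (Reps : {set gT}) m (u : gT) :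
    is_transversal Reps (classes 'C[u]) 'C[u] ->
    Gtilde_pow Reps m u = set0 \/ Gtilde_pow Reps m u = [set 1] ->
  forall h, h \in Gtilde m u -> h ^+ m = 1.
Proof.
move=> /and3P[_ _ /forall_inP trR] powR h hG.
have := trR (h ^+ m ^: 'C[u]) (mem_classes (Gtilde_pow_cent hG)).
case/cards1P => y /setP/(_ y); rewrite !inE eqxx => /andP[yR /class_eqP Ey].
have yP : y \in Gtilde_pow Reps m u.
  by rewrite inE yR; apply/exists_inP; exists h; rewrite // Ey class_refl.
case: powR yP => ->; rewrite !inE // => /eqP y1.
by apply/set1gP; rewrite -(class1G 'C[u]%G) -y1 Ey class_refl.
Qed.

Theorem lemma3p3p7 (R : realType) (gT : finGroupType) (u : gT)
    (Reps : {set gT}) :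
  is_transversal Reps (classes 'C[u]) 'C[u] ->
  abelian 'C[u] ->
  (forall m : nat, (0 < m)%N ->
     Gtilde_pow Reps m u = set0 \/ Gtilde_pow Reps m u = [set 1]) ->
  forall chi chi' : ddouble R[i] gT -> R[i],
    induced_character u chi -> induced_character u chi' ->
    I_equivalent chi chi'.
Proof.
move=> trR abC powR chi chi' [n [rV [irrV Echi]]] [n' [rV' [irrV' Echi']]].
move=> m m_gt0.
have splitC : group_splitting_field R[i] 'C[u].
  exact: group_closure_closed_field.
have n1 := mx_irr_abelian_linear splitC irrV abC.
have n1' := mx_irr_abelian_linear splitC irrV' abC.
subst n n'.
have pow1 := Gtilde_pow1 trR (powR m m_gt0).
have E := FS_indicator_ind_char rV rV' m_gt0 pow1.
rewrite /FS_indicator (Echi _) (Echi' _).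
exact: E.
Qed.
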